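(* Suppose that $\|\hat{\boldsymbol\beta}^\lambda\|=O_p(1)$, and that the empirical distributions $p^{-1}\sum_{j=1}^p\delta_{\sqrt n\beta_j}$ and $n^{-1}\sum_{i=1}^n\delta_{\varepsilon_i}$ converge in the $2$-Wasserstein sense to the distributions of random variables $\bar\beta$ and $\bar\varepsilon$, respectively, both having finite second moments. Assume one of the following two regimes: (i) $\lambda>0$, $\boldsymbol\Sigma=\boldsymbol I_p$, and $\kappa\in(0,\infty)$; (ii) $\lambda=0$, $\boldsymbol\Sigma$ an arbitrary $p\times p$ symmetric positive definite matrix, and $\kappa\in(0,1)$. Then the SE system of $\hat{\boldsymbol\beta}^\lambda$ (the system of equations characterizing the fixed points $(\mu,\sigma,\eta)\in\mathbb R\times(0,\infty)^2$ of the state evolution recursion associated with $\hat{\boldsymbol\beta}^\lambda$) is given by $$\begin{cases}\kappa^2\sigma^2=\eta^2\,\mathbb E\left[(\bar Y-g(L))^2\right],\\ \gamma^2\lambda\mu=\mathbb E\left[Z(\bar Y-g(L))\right],\\ 1-\kappa+\lambda\eta=\mathbb E\left[(1+\eta g'(L))^{-1}\right],\end{cases}$$ where $L=\mathrm{prox}_{\eta G}(\mu Z+\sqrt\kappa\,\sigma Q_2+\eta\bar Y)$, $Z=\gamma Q_1$, $(Q_1,Q_2)\sim\mathcal N_2(\boldsymbol 0,\boldsymbol I_2)$, $\bar Y=h(Z,\bar\varepsilon)$, $\bar\varepsilon$ is independent of $(Q_1,Q_2)$, and the expectations are over $(Q_1,Q_2,\bar Y)$.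
   Context: Setting. For each $n$, with $p=p(n)$ and $p(n)/n\to\kappa\in(0,\infty)$ as $n\to\infty$, one observes $n$ i.i.d. pairs $(\boldsymbol X_i,Y_i)$ with $\boldsymbol X_i\sim\mathcal N_p(\boldsymbol 0,\boldsymbol\Sigma)$, $\boldsymbol\Sigma=\boldsymbol\Sigma(n)$, following the generalized linear model $\mathbb E[Y_i\mid\boldsymbol X_i]=g(\boldsymbol X_i^\top\boldsymbol\beta)$, where $\boldsymbol\beta=\boldsymbol\beta(n)\in\mathbb R^p$ is deterministic and $g:\mathbb R\to\mathbb R$ is a known, monotonically increasing, almost everywhere differentiable function. The response is written $Y_i=h(\boldsymbol X_i^\top\boldsymbol\beta,\varepsilon_i)$ with a deterministic $h:\mathbb R^2\to\mathbb R$ and a random variable $\varepsilon_i$ independent of $\boldsymbol X_i$. The signal strength is $\gamma^2=\lim_{n\to\infty}\mathrm{Var}(\boldsymbol X_i^\top\boldsymbol\beta)=\lim_{n\to\infty}\boldsymbol\beta^\top\boldsymbol\Sigma\boldsymbol\beta\in(0,\infty)$. $G$ is a function with $G'=g$. For convex $f:\mathbb R\to\mathbb R$ and $\eta>0$, $\mathrm{prox}_{\eta f}(x)=\arg\min_{z\in\mathbb R}\{\eta f(z)+(x-z)^2/2\}$. The (ridge-penalized) surrogate estimator is, for $\lambda\ge0$, $$\hat{\boldsymbol\beta}^\lambda\in\arg\min_{\boldsymbol b\in\mathbb R^p}\Big\{\sum_{i=1}^n\big(G(\boldsymbol X_i^\top\boldsymbol b)-Y_i\boldsymbol X_i^\top\boldsymbol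 b\big)+\tfrac{n\lambda}{2}\|\boldsymbol b\|^2\Big\}.$$ State evolution recursion. For $\boldsymbol\Sigma=\boldsymbol I_p$, the (scalar) state evolution recursion of the generalized approximate message passing algorithm whose limit is $\sqrt n\,\hat{\boldsymbol\beta}^\lambda$ is $$\eta_{k+1}=\kappa\eta_k\Big(\lambda\eta_k+1-\mathbb E\Big[\tfrac1{1+\eta_kg'(d_k)}\Big]\Big)^{-1},$$ $$\mu_{k+1}=\frac{\eta_{k+1}}{\kappa\gamma^2}\mathbb E\big[\gamma Q_1\{h(\gamma Q_1,\bar\varepsilon)-g(d_k)\}\big]+\mu_k\big(1-\lambda\kappa^{-1}\eta_{k+1}\big),$$ $$\sigma_{k+1}^2=\frac{\eta_{k+1}^2}{\kappa^2}\mathbb E\big[\{h(\gamma Q_1,\bar\varepsilon)-g(d_k)\}^2\big],$$ with $d_k=\mathrm{prox}_{\eta_kG}(\mu_k\gamma Q_1+\sqrt\kappa\,\sigma_kQ_2+\eta_kh(\gamma Q_1,\bar\varepsilon))$, $(Q_1,Q_2)\sim\mathcal N_2(\boldsymbol 0,\boldsymbol I_2)$ independent of $\bar\varepsilon$. The ''SE system'' of $\hat{\boldsymbol\beta}^\lambda$ is the system of equations for a fixed point $(\mu,\sigma,\eta)\in\mathbb R\times(0,\infty)^2$ of this recursion. For general $\boldsymbol\Sigma=\boldsymbol L\boldsymbol L^\top$ and $\lambda=0$, the SE system of $\hat{\boldsymbol\beta}^0$ is that of the isotropic-design estimator $\boldsymbol L^\top\hat{\boldsymbol\beta}^0$, which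 is the surrogate estimator for the covariates $\boldsymbol L^{-1}\boldsymbol X_i\sim\mathcal N_p(\boldsymbol 0,\boldsymbol I_p)$ and the coefficient $\boldsymbol L^\top\boldsymbol\beta$. *)

(* Defs.v *)
From HB Require Import structures.
From mathcomp Require Import all_boot all_order all_algebra.
From mathcomp Require Import all_classical all_reals all_analysis.

Set Implicit Arguments.
Unset Strict Implicit.
Unset Printing Implicit Defensive.

Import Order.TTheory GRing.Theory Num.Theory.
Import numFieldNormedType.Exports.

Local Open Scope classical_set_scope.
Local Open Scope ring_scope.

Section euclidean.
Context {R : realType}.

Definition dotv {p : nat} (u v : 'cV[R]_p) : R := (u^T *m v) 0 0.

(* The library norm on matrices is the sup norm. *)
Definition enorm {p : nat} (u : 'cV[R]_p) : R := Num.sqrt (dotv u u).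

Definition quadf {p : nat} (S : 'M[R]_p) (u : 'cV[R]_p) : R :=
  (u^T *m S *m u) 0 0.

Definition posdef {p : nat} (S : 'M[R]_p) : Prop :=
  S^T = S /\ forall u : 'cV[R]_p, u != 0 -> 0 < quadf S u.

Definition vborel (p : nat) : set (set 'cV[R]_p) := <<s [set B | open B] >>.

End euclidean.

Section random_vectors.
Context {R : realType} {d : measure_display} {T : measurableType d}.
Variable P : probability T R.

Definition random_vector {p : nat} (X : T -> 'cV[R]_p) : Prop :=
  forall B, vborel B -> measurable (X @^-1` B).

(* N(0, v); the library's [normal_prob 0 0] is not the Dirac mass at 0. *)
Definition centered_normal (v : R) (A : set R) : \bar R :=
  if v == 0 then \d_(0 : R) A else normal_prob 0 (Num.sqrt v) A.

(* X ~ N_p(0, S): every linear functional a of X has law N(0, a^T S a). *)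
Definition gaussian_vector {p : nat} (S : 'M[R]_p) (X : T -> 'cV[R]_p) : Prop :=
  random_vector X /\
  forall (a : 'cV[R]_p) (A : set R), measurable A ->
    P [set w | A (dotv a (X w))] = centered_normal (quadf S a) A.

Definition indep_vec_var {p : nat} (X : T -> 'cV[R]_p) (e : T -> R) : Prop :=
  forall (B : set 'cV[R]_p) (C : set R), vborel B -> measurable C ->
    (P (X @^-1` B `&` e @^-1` C) = P (X @^-1` B) * P (e @^-1` C))%E.

Definition iid_vectors {n p : nat} (V : 'I_n -> T -> 'cV[R]_p) : Prop :=
  [/\ forall i, random_vector (V i),
      forall B : 'I_n -> set 'cV[R]_p, (forall i, vborel (B i)) ->
        P (\bigcap_(i in setT) (V i @^-1` B i)) =
        (\prod_(i < n) P (V i @^-1` B i))%E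
    & forall i j B, vborel B -> P (V i @^-1` B) = P (V j @^-1` B)].

(* E[Y | X] = v(X). *)
Definition cond_expectation {p : nat} (X : T -> 'cV[R]_p) (Y : T -> R)
    (v : 'cV[R]_p -> R) : Prop :=
  [/\ P.-integrable setT (EFin \o Y),
      P.-integrable setT (EFin \o (v \o X)),
      forall B, measurable B -> vborel (v @^-1` B)
    & forall B, vborel B ->
        (\int[P]_(w in X @^-1` B) (Y w)%:E =
         \int[P]_(w in X @^-1` B) (v (X w))%:E)%E].

(* E has inner probability at least 1 - e; no measurability of E is needed. *)
Definition prob_ge (E : set T) (e : R) : Prop :=
  exists A, [/\ measurable A, A `<=` E & ((1 - e)%:E <= P A)%E].

(* Infinite or undefined expectations are sent to 0. *)
Definition mean (X : T -> R) : R := fine 'E_P[X]%E.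

End random_vectors.

Section wasserstein.
Context {R : realType}.

Definition empirical {n : nat} (x : 'I_n -> R) (A : set R) : \bar R :=
  ((n%:R^-1)%:E * \sum_(i < n) \d_(x i) A)%E.

Definition coupling (mu nu : set R -> \bar R)
    (c : {measure set (R * R)%type -> \bar R}) : Prop :=
  forall A : set R, measurable A ->
    c (A `*` setT) = mu A /\ c (setT `*` A) = nu A.

Definition wasserstein2 (mu nu : set R -> \bar R) : \bar R :=
  poweR (ereal_inf [set x : \bar R | exists2 c, coupling mu nu c &
           x = (\int[c]_z (((z.1 - z.2) ^+ 2)%:E))%E]) 2^-1.

End wasserstein.

(* A triangular array of observations; the row n lives on its own probability
   space, so the rows may be coupled arbitrarily. *)
Record glm_array (R : realType) := GlmArray {
  gdisp : nat -> measure_display ;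
  gspace : forall n, measurableType (gdisp n) ;
  gprob : forall n, probability (gspace n) R ;
  gdim : nat -> nat ;
  gcov : forall n, 'M[R]_(gdim n) ;
  gcoef : forall n, 'cV[R]_(gdim n) ;
  gX : forall n, 'I_n -> gspace n -> 'cV[R]_(gdim n) ;
  geps : forall n, 'I_n -> {RV (gprob n) >-> R} ;
  gY : forall n, 'I_n -> gspace n -> R
}.

Section glm.
Context {R : realType}.
Implicit Types (M : glm_array R) (h : R -> R -> R) (g G : R -> R).

Record glm_setting M h g G (kappa gamma : R) : Prop := GlmSetting {
  gs_kappa : 0 < kappa ;
  gs_ratio : ((gdim M n)%:R / n%:R : R) @[n --> \oo] --> kappa ;
  gs_gamma : 0 < gamma ;
  gs_signal : quadf (gcov M n) (gcoef M n) @[n --> \oo] --> gamma ^+ 2 ;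
  gs_g_incr : {homo g : x y / x <= y} ;
  gs_g_diff : {ae lebesgue_measure, forall x : R, derivable g x 1} ;
  gs_G : forall x : R, is_derive x 1 G (g x) ;
  gs_h : measurable_fun setT (fun z : R * R => h z.1 z.2) ;
  gs_X : forall n (i : 'I_n), gaussian_vector (gprob M n) (gcov M n) (gX i) ;
  gs_iid : forall n, iid_vectors (gprob M n)
    (fun (i : 'I_n) w => col_mx (gX i w) (gY i w)%:M) ;
  gs_Y : forall n (i : 'I_n) (w : gspace M n),
    gY i w = h (dotv (gX i w) (gcoef M n)) (geps M i w) ;
  gs_indep : forall n (i : 'I_n), indep_vec_var (gprob M n) (gX i) (geps M i) ;
  gs_cond : forall n (i : 'I_n), cond_expectation (gprob M n) (gX i) (gY i)
    (fun x => g (dotv x (gcoef M n)))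
}.

Definition surrogate_loss M G (lam : R) n (w : gspace M n)
    (b : 'cV[R]_(gdim M n)) : R :=
  \sum_(i < n) (G (dotv (gX i w) b) - gY i w * dotv (gX i w) b)
  + n%:R * lam / 2 * enorm b ^+ 2.

Definition is_surrogate M G lam n (w : gspace M n) (b : 'cV[R]_(gdim M n)) :=
  forall b', surrogate_loss G lam w b <= surrogate_loss G lam w b'.

(* With probability tending to one the minimum exists and [bhat] attains it. *)
Definition surrogate_estimator M G lam
    (bhat : forall n, gspace M n -> 'cV[R]_(gdim M n)) : Prop :=
  forall e : R, 0 < e -> \forall n \near \oo,
    prob_ge (gprob M n) [set w | is_surrogate G lam w (bhat n w)] e.

Definition norm_Op1 M (bhat : forall n, gspace M n -> 'cV[R]_(gdim M n)) :=
  forall e : R, 0 < e -> exists B : R, \forall n \near \oo,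
    prob_ge (gprob M n) [set w | enorm (bhat n w) <= B] e.

Definition coef_W2_cvg M (mu : set R -> \bar R) : Prop :=
  wasserstein2 (empirical (fun j => Num.sqrt n%:R * gcoef M n j 0)) mu
    @[n --> \oo] --> 0%E.

Definition noise_W2_cvg M (mu : set R -> \bar R) : Prop :=
  forall delta e : R, 0 < delta -> 0 < e -> \forall n \near \oo,
    prob_ge (gprob M n)
      [set w | (wasserstein2 (empirical (fun i : 'I_n => geps M i w)) mu
                <= delta%:E)%E] e.

Definition prox (f : R -> R) (x : R) : R :=
  get [set z : R | forall y : R,
         f z + (x - z) ^+ 2 / 2 <= f y + (x - y) ^+ 2 / 2].

Definition aspect_ratio M : R := lim (((gdim M n)%:R / n%:R : R) @[n --> \oo]).

(* quadf Sigma beta = Var(X_i^T beta) for X_i ~ N(0, Sigma). *)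
Definition signal_strength M : R :=
  Num.sqrt (lim (quadf (gcov M n) (gcoef M n) @[n --> \oo])).

(* One step (mu, sigma, eta) -> (mu', sigma', eta') of the recursion. *)
Definition se_step {d : measure_display} {T : measurableType d}
    (P : probability T R) (Q : T -> 'cV[R]_2) (epsbar : T -> R) h g G
    (kappa gamma lam : R) (mu sigma eta mu' sigma' eta' : R) : Prop :=
  let Q1 w := Q w 0 0 in
  let Q2 w := Q w 1 0 in
  let Y w := h (gamma * Q1 w) (epsbar w) in
  let D w := prox (fun z => eta * G z)
    (mu * gamma * Q1 w + Num.sqrt kappa * sigma * Q2 w + eta * Y w) in
  [/\ eta' = kappa * eta *
        (lam * eta + 1 - mean P (fun w => 1 / (1 + eta * derive1 g (D w))))^-1,
      mu' = eta' / (kappa * gamma ^+ 2)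
              * mean P (fun w => gamma * Q1 w * (Y w - g (D w)))
            + mu * (1 - lam * kappa^-1 * eta')
    & sigma' ^+ 2 = eta' ^+ 2 / kappa ^+ 2
              * mean P (fun w => (Y w - g (D w)) ^+ 2)].

(* SE system of the surrogate estimator in an array with isotropic design.
   As 0 < sigma, the expectation in the sigma equation is positive and finite,
   so the one in the mu equation converges. *)
Definition se_system_iso {d : measure_display} {T : measurableType d}
    (P : probability T R) (Q : T -> 'cV[R]_2) (epsbar : T -> R) h g G
    M (lam mu sigma eta : R) : Prop :=
  [/\ 0 < sigma, 0 < eta &
      se_step P Q epsbar h g G (aspect_ratio M) (signal_strength M) lam
              mu sigma eta mu sigma eta].

(* Change of coordinates to covariates L^-1 X ~ N(0, I) and coefficient
   L^T beta, when the covariance is L L^T. *)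
Definition whiten M (L : forall n, 'M[R]_(gdim M n)) : glm_array R :=
  @GlmArray R (gdisp M) (gspace M) (gprob M) (gdim M)
    (fun n => 1%:M)
    (fun n => (L n)^T *m gcoef M n)
    (fun n i w => invmx (L n) *m gX i w)
    (geps M) (gY (g:=M)).

(* SE system of the surrogate estimator: without penalty it is the one of
   L^T bhat in the whitened array; with a penalty the design is isotropic. *)
Definition se_system {d : measure_display} {T : measurableType d}
    (P : probability T R) (Q : T -> 'cV[R]_2) (epsbar : T -> R) h g G
    M (L : forall n, 'M[R]_(gdim M n)) (lam mu sigma eta : R) : Prop :=
  se_system_iso P Q epsbar h g G (if lam == 0 then whiten L else M)
    lam mu sigma eta.

Definition regime_ridge M (lam : R) : Prop :=
  0 < lam /\ forall n, gcov M n = 1%:M.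

Definition regime_unpenalized M (L : forall n, 'M[R]_(gdim M n))
    (kappa lam : R) : Prop :=
  [/\ lam = 0, kappa < 1, forall n, posdef (gcov M n)
    & forall n, gcov M n = L n *m (L n)^T].

Lemma whiten_dot p (A : 'M[R]_p) (x b : 'cV[R]_p) : A \in unitmx ->
  dotv (invmx A *m x) (A^T *m b) = dotv x b.
Proof.
by move=> uA; rewrite /dotv trmx_mul trmx_inv mulmxA -(mulmxA x^T) mulVmx
  ?unitmx_tr// mulmx1.
Qed.

Lemma whiten_surrogate M (L : forall n, 'M[R]_(gdim M n)) G n
    (w : gspace M n) (b : 'cV[R]_(gdim M n)) : L n \in unitmx ->
  is_surrogate G 0 w b ->
  @is_surrogate (whiten L) G 0 n w ((L n)^T *m b).
Proof.
move=> uL bmin b'; have uLT : (L n)^T \in unitmx by rewrite unitmx_tr.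
rewrite -[b'](mulKVmx uLT); set c := (X in _ *m X).
have E x : @surrogate_loss (whiten L) G 0 n w ((L n)^T *m x) =
           surrogate_loss G 0 w x.
  by rewrite /surrogate_loss !mulr0 !mul0r /=; congr (_ + _);
    apply: eq_bigr => i _; rewrite whiten_dot.
by rewrite !E; exact: bmin.
Qed.

End glm.

(* Main.v *)
Require Import Defs.
From mathcomp Require Import all_boot all_order all_algebra.
From mathcomp Require Import ring.
From mathcomp Require Import all_classical all_reals all_analysis.
Set Implicit Arguments.
Unset Strict Implicit.
Unset Printing Implicit Defensive.
Import Order.TTheory GRing.Theory Num.Theory.
Import numFieldNormedType.Exports.
Local Open Scope classical_set_scope.
Local Open Scope ring_scope.

(** A fixed point of the recursion is a triple with
[(mu', sigma', eta') = (mu, sigma, eta)], so the proof is an elimination in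
each of the three update equations, which the expectations enter as opaque
numbers.

As [eta > 0], the update of [eta] cancels to [1 = kappa / D], where
[D = lam * eta + 1 - E[1 / (1 + eta * g')]]; hence [D = kappa], which is the
third equation of the system.  In the update of [mu] the two terms [mu]
cancel, and what remains has the common nonzero factor [eta / kappa].  The
update of [sigma ^ 2] only needs its denominator cleared.  This is
[se_fixed_pointP].

The recursion is stated with the limits of the array to which the estimator
belongs, so these have to be identified with [kappa] and [gamma].  With a
penalty they are the limits assumed of the array itself.  Without penalty the
array is the whitened one, which has the same dimensions, and the same signal
strength because [|L^T beta|^2 = beta^T (L L^T) beta]
([quadf_whiten]). *)

(** Dividing by [D = lam * eta + 1 - mE] needs no assumption [D != 0]: the
inverse of zero is zero, so the update then returns [0], which is no fixed
point as [eta > 0], while the third equation on the right says [D = kappa] and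
fails as well. *)
Lemma se_fixed_pointP (R : realFieldType)
    (kappa gamma lam mu sigma eta mE mZ mS : R) :
  0 < kappa -> 0 < gamma -> 0 < eta ->
  [/\ eta = kappa * eta * (lam * eta + 1 - mE)^-1,
      mu = eta / (kappa * gamma ^+ 2) * mZ + mu * (1 - lam * kappa^-1 * eta)
    & sigma ^+ 2 = eta ^+ 2 / kappa ^+ 2 * mS] <->
  [/\ kappa ^+ 2 * sigma ^+ 2 = eta ^+ 2 * mS,
      gamma ^+ 2 * lam * mu = mZ
    & 1 - kappa + lam * eta = mE].
Proof.
move=> /lt0r_neq0 k0 /lt0r_neq0 g0 /lt0r_neq0 e0; split=> [[He Hm Hs]|[Hs Hm He]].
- split.
  + by rewrite Hs; field.
  + have c0 : eta / (kappa * gamma ^+ 2) != 0.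
      by rewrite mulf_neq0// invr_neq0// mulf_neq0// expf_neq0.
    apply: (mulfI c0); apply/eqP; rewrite -subr_eq0; apply/eqP.
    transitivity (mu - (eta / (kappa * gamma ^+ 2) * mZ
                        + mu * (1 - lam * kappa^-1 * eta))).
      by field; rewrite k0.
    by rewrite -Hm subrr.
  + have D0 : lam * eta + 1 - mE != 0.
      by apply: contra_neq e0 => D0; rewrite He D0 invr0 mulr0.
    have Dk : lam * eta + 1 - mE = kappa.
      by apply: (mulIf e0); rewrite mulrC {1}He mulfVK.
    by rewrite -Dk; ring.
- split.
  + have -> : lam * eta + 1 - mE = kappa by rewrite -He; ring.
    by field.
  + by rewrite -Hm; field; rewrite k0.
  + by rewrite mulrAC -Hs; field.
Qed.

Lemma quadf_whiten (R : realType) p (A : 'M[R]_p) (b : 'cV[R]_p) :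
  quadf 1%:M (A^T *m b) = quadf (A *m A^T) b.
Proof. by rewrite /quadf mulmx1 trmx_mul trmxK !mulmxA. Qed.

Lemma aspect_ratioE (R : realType) (M : glm_array R) (kappa : R) :
  ((gdim M n)%:R / n%:R : R) @[n --> \oo] --> kappa -> aspect_ratio M = kappa.
Proof. by move=> /cvg_lim; apply. Qed.

Lemma signal_strengthE (R : realType) (M : glm_array R) (gamma : R) :
  0 < gamma ->
  quadf (gcov M n) (gcoef M n) @[n --> \oo] --> gamma ^+ 2 ->
  signal_strength M = gamma.
Proof.
by move=> g0 /cvg_lim E; rewrite /signal_strength E// sqrtr_sqr gtr0_norm.
Qed.

Theorem proposition2 (R : realType) (M : glm_array R)
    (h : R -> R -> R) (g G : R -> R) (kappa gamma lam : R)
    (L : forall n, 'M[R]_(gdim M n))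
    (betahat : forall n, gspace M n -> 'cV[R]_(gdim M n))
    (d0 : measure_display) (T0 : measurableType d0) (P0 : probability T0 R)
    (betabar : {RV P0 >-> R})
    (d1 : measure_display) (T1 : measurableType d1) (P1 : probability T1 R)
    (Q : T1 -> 'cV[R]_2) (epsbar : {RV P1 >-> R}) :
  glm_setting M h g G kappa gamma ->
  surrogate_estimator G lam betahat ->
  norm_Op1 betahat ->
  ('E_P0[(fun w => betabar w ^+ 2)%R] < +oo)%E ->
  ('E_P1[(fun w => epsbar w ^+ 2)%R] < +oo)%E ->
  coef_W2_cvg M (distribution P0 betabar) ->
  noise_W2_cvg M (distribution P1 epsbar) ->
  gaussian_vector P1 (1%:M : 'M[R]_2) Q ->
  indep_vec_var P1 Q epsbar ->
  regime_ridge M lam \/ regime_unpenalized L kappa lam ->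
  forall mu sigma eta : R,
  se_system P1 Q epsbar h g G L lam mu sigma eta <->
  let Z w := gamma * Q w 0 0 in
  let Ybar w := h (Z w) (epsbar w) in
  let Lp w := prox (fun z => eta * G z)
    (mu * Z w + Num.sqrt kappa * sigma * Q w 1 0 + eta * Ybar w) in
  [/\ 0 < sigma /\ 0 < eta,
      kappa ^+ 2 * sigma ^+ 2 =
        eta ^+ 2 * mean P1 (fun w => (Ybar w - g (Lp w)) ^+ 2),
      gamma ^+ 2 * lam * mu = mean P1 (fun w => Z w * (Ybar w - g (Lp w)))
    & 1 - kappa + lam * eta = mean P1 (fun w => (1 + eta * derive1 g (Lp w))^-1)].
Proof.
move=> gs _ _ _ _ _ _ _ _ regime mu sigma eta /=.
have k0 := gs_kappa gs; have g0 := gs_gamma gs.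
rewrite /se_system; set N := (if lam == 0 then _ else _).
have Nk : aspect_ratio N = kappa.
  apply: aspect_ratioE; rewrite /N; case: ifP => _; exact: gs_ratio gs.
have Ng : signal_strength N = gamma.
  apply: signal_strengthE => //; rewrite /N.
  case: regime => [[lam0 _]|[-> _ _ covE]].
    by rewrite gt_eqF//; exact: gs_signal gs.
  rewrite eqxx /=.
  under eq_fun do rewrite quadf_whiten -covE.
  exact: gs_signal gs.
rewrite /se_system_iso /se_step /= Nk Ng.
(* The two sides differ only by [1 / x] against [x^-1] and by the bracketing of
   [mu * gamma * Q1] under the expectations. *)
under eq_fun do rewrite div1r -mulrA.
under [in X in _ * mean _ X + _]eq_fun do rewrite -[mu * gamma * _]mulrA.
under [in X in _ = _ / _ * mean _ X]eq_fun do rewrite -[mu * gamma * _]mulrA.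
split=> [[s0 e0 H]|[[s0 e0] H1 H2 H3]].
  by have [] := (se_fixed_pointP _ _ _ _ _ _ k0 g0 e0).1 H.
by split=> //; apply/(se_fixed_pointP _ _ _ _ _ _ k0 g0 e0).
Qed.
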